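(* Let $\mathbb{H}_1$ be a hyperfield which satisfies the multiplicity equality and has the inheritance property, and let $\mathbb{H}_2$ be a hyperfield that satisfies the multiplicity bound. Then any hyperfield homomorphism $f:\mathbb{H}_1\to\mathbb{H}_2$ is relatively algebraically closed (RAC).
   Context: A hyperoperation on a set $\mathbb{H}$ is a map $\boxplus:\mathbb{H}\times\mathbb{H}\to\{\text{nonempty subsets of }\mathbb{H}\}$; for subsets, $A\boxplus B=\bigcup_{a\in A,b\in B}(a\boxplus b)$, and finite hypersums are defined by iteration. A hyperfield is a tuple $(\mathbb{H},\odot,\boxplus,1,0)$ with $0\ne 1$ such that: $(\mathbb{H},\odot,1)$ is a commutative monoid in which every nonzero element is invertible; $\boxplus$ is a commutative and associative hyperoperation; $0\boxplus x=\{x\}$; for each $x$ there is a unique $-x$ with $0\in x\boxplus(-x)$; $x\in y\boxplus z$ iff $z\in x\boxplus(-y)$; $0\odot x=0$; and $a\odot(x\boxplus y)=(a\odot x)\boxplus(a\odot y)$. A hyperfield homomorphism $f:\mathbb{H}_1\to\mathbb{H}_2$ is a map with $f(x\boxplus_1 y)\subseteq f(x)\boxplus_2 f(y)$, $f(x\odot_1 y)=f(x)\odot_2 f(y)$, $f(0)=0$, $f(1)=1$. $\mathbb{H}[X]$ is the set of formal expressions $p=\boxplus_{i=0}^n c_i\odot X^i$ with $c_i\in\mathbb{H}$; polynomials are taken to be nonzero, and $\deg(p)$ is the largest $i$ with $c_i\neq0$. Put $p(a)=\boxplus_i c_i\odot a^i\subseteq\mathbb{H}$ and $V(p)=\{a\in\mathbb{H}:0\in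 p(a)\}$, the set of roots. The push-forward is $f_*(p)=\boxplus_i f(c_i)\odot X^i$. Products of polynomials are multivalued: for $q=\boxplus_i d_i\odot X^i$, $(X-a)\odot q$ (also written $(X\boxplus -a)\odot q$) is the set of all polynomials $\boxplus_i e_i\odot X^i$ with $e_i\in d_{i-1}\boxplus(-a\odot d_i)$ for all $i\ge0$ (where $d_{j}=0$ for indices outside the range of $q$). Iterated products are $(X-a_1)\odot\cdots\odot(X-a_m)\odot q=(X-a_1)\odot\big((X-a_2)\odot(\cdots\odot((X-a_m)\odot q))\big)$, where $(X-a)\odot Q=\bigcup_{q\in Q}(X-a)\odot q$ for a set $Q$ of polynomials. Multiplicity: $\mathrm{mult}_a(p)=0$ if $a$ is not a root of $p$; otherwise $\mathrm{mult}_a(p)=1+\max\{\mathrm{mult}_a(q): q\in\mathbb{H}[X],\ p\in(X\boxplus -a)\odot q\}$. $\mathbb{H}$ satisfies the multiplicity bound if $\sum_{a\in\mathbb{H}}\mathrm{mult}_a(p)\le\deg(p)$ for all univariate polynomials $p\in\mathbb{H}[X]$, and the multiplicity equality if this is an equality for all univariate polynomials. Inheritance: for $p\in\mathbb{H}[X]$ let $A_p$ be the list (multiset) of roots of $p$, each repeated according to its multiplicity. $\mathbb{H}$ has the inheritance property at $p$ if for every sub-multiset $\{a_{j_1},\dots,a_{j_m}\}\subseteq A_p$ (listed in any order) with $m\le\deg(p)$ there exists $q\in\mathbb{H}[X]$ such that $p\in(X-a_{j_1})\odot\cdots\odot(X-a_{j_m})\odot q$. $\mathbb{H}$ has the inheritance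 property if this holds at every $p\in\mathbb{H}[X]$. $f:\mathbb{H}_1\to\mathbb{H}_2$ is relatively algebraically closed (RAC) if for all univariate $p\in\mathbb{H}_1[X]$ and every root $b\in V(f_*(p))$ there exists $a\in f^{-1}(b)$ with $a\in V(p)$. *)

(* Defs.v *)
From HB Require Import structures.
From mathcomp Require Import all_boot.
From mathcomp Require Import boolp classical_sets functions cardinality fsbigop.

Set Implicit Arguments.
Unset Strict Implicit.
Unset Printing Implicit Defensive.

Local Open Scope classical_set_scope.

Definition set_hyperadd (T : Type) (add : T -> T -> set T) (A B : set T) :
  set T := \bigcup_(a in A) \bigcup_(b in B) add a b.

HB.mixin Record isHyperfield (T : Type) of Choice T := {
  hzero : T;
  hone : T;
  hopp : T -> T;
  hmul : T -> T -> T;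
  hadd : T -> T -> set T;
  hone_neq0 : hzero <> hone;
  hmulA : associative hmul;
  hmulC : commutative hmul;
  hmul1x : left_id hone hmul;
  hmul_inv : forall x, x <> hzero -> exists y, hmul x y = hone;
  hadd_nonempty : forall x y, hadd x y !=set0;
  haddC : commutative hadd;
  haddA : forall x y z,
    set_hyperadd hadd [set x] (hadd y z) = set_hyperadd hadd (hadd x y) [set z];
  hadd0x : forall x, hadd hzero x = [set x];
  haddxN : forall x, hadd x (hopp x) hzero;
  hopp_unique : forall x y, hadd x y hzero -> y = hopp x;
  hadd_rev : forall x y z, hadd y z x <-> hadd x (hopp y) z;
  hmul0x : left_zero hzero hmul;
  hmulDr : forall a x y, hmul a @` hadd x y = hadd (hmul a x) (hmul a y)
}.

#[short(type="hyperfieldType")]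
HB.structure Definition Hyperfield := {T of isHyperfield T & Choice T}.

Arguments hzero {s}.
Arguments hone {s}.

Section Polynomials.
Variable H : hyperfieldType.

Definition hexp (a : H) (n : nat) : H := iter n (hmul a) hone.

(* A nonzero polynomial is its list of coefficients, constant term first, with
   nonzero last entry; the default value [hzero] of [last] excludes the empty
   list, i.e. the zero polynomial. *)
Record hpoly := HPoly { hpolyseq :> seq H; _ : last hzero hpolyseq != hzero }.

Definition hcoef (p : hpoly) (i : nat) : H := nth hzero p i.

Definition hdeg (p : hpoly) : nat := (size p).-1.

Definition heval (p : hpoly) (a : H) : set H :=
  \big[set_hyperadd hadd/[set hzero]]_(i < size p)
    [set hmul (hcoef p i) (hexp a i)].

Definition hroots (p : hpoly) : set H := [set a | heval p a hzero].

(* Every polynomial whose coefficients satisfy these conditions is nonzero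
   (its leading coefficient is that of [q]), so nothing is lost by collecting
   only elements of [hpoly]. *)
Definition mulXsub (a : H) (q : hpoly) : set hpoly :=
  [set p | forall i, hadd (if i is j.+1 then hcoef q j else hzero)
                          (hmul (hopp a) (hcoef q i)) (hcoef p i)].

Definition mulXsub_seq (s : seq H) (q : hpoly) : set hpoly :=
  foldr (fun a Q => \bigcup_(r in Q) mulXsub a r) [set q] s.

Definition is_max (A : set nat) (m : nat) : Prop :=
  A m /\ forall n, A n -> n <= m.

Definition set_max (A : set nat) : nat := xget 0 (is_max A).

(* A quotient has degree one less, so [hdeg p] recursive calls suffice; [multE]
   below is the fuel-free recursion, and [mult_max] shows that the maximum in
   it exists at every root. *)
Fixpoint mult_rec (n : nat) (a : H) (p : hpoly) : nat :=
  if n is m.+1 then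
    if `[< hroots p a >] then
      (set_max [set mult_rec m a q | q in [set q | mulXsub a q p]]).+1
    else 0
  else 0.

Definition mult (a : H) (p : hpoly) : nat := mult_rec (hdeg p) a p.

End Polynomials.

Section MultiplicityConditions.
Variable H : hyperfieldType.

(* A big operator over a classical set is [0] when infinitely many terms are
   nonzero; such a sum counts as infinite here, so finiteness is required. *)
Definition multiplicity_bound : Prop :=
  forall p : hpoly H, finite_set [set a | mult a p != 0] /\
    \big[addn/0]_(a \in [set: H]) mult a p <= hdeg p.

Definition multiplicity_equality : Prop :=
  forall p : hpoly H, finite_set [set a | mult a p != 0] /\
    \big[addn/0]_(a \in [set: H]) mult a p = hdeg p.

(* The lists [s] with [count_mem a s <= mult a p] for all [a] are exactly the
   orderings of the finite sub-multisets of the multiset of roots of [p]. *)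
Definition inheritance_at (p : hpoly H) : Prop :=
  forall s : seq H,
    (forall a, count_mem a s <= mult a p) -> size s <= hdeg p ->
    exists q : hpoly H, mulXsub_seq s q p.

Definition inheritance_property : Prop :=
  forall p : hpoly H, inheritance_at p.

End MultiplicityConditions.

Record hyperfield_hom (H1 H2 : hyperfieldType) := HyperfieldHom {
  hom_fun :> H1 -> H2;
  hom_add : forall x y,
    hom_fun @` hadd x y `<=` hadd (hom_fun x) (hom_fun y);
  hom_mul : {morph hom_fun : x y / hmul x y};
  hom0 : hom_fun hzero = hzero;
  hom1 : hom_fun hone = hone
}.

Section PushForward.
Variables (H1 H2 : hyperfieldType) (f : hyperfield_hom H1 H2).

Lemma hom_neq0 x : x != hzero -> f x != hzero.
Proof.
move=> /eqP/hmul_inv[y xy1]; apply/eqP => fx0.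
have := congr1 f xy1; rewrite hom_mul fx0 hmul0x hom1; exact: hone_neq0.
Qed.

Lemma push_subproof (p : hpoly H1) : last hzero (map f p) != hzero.
Proof. by case: p => s sN0 /=; rewrite -(hom0 f) last_map hom0 hom_neq0. Qed.

Definition push_forward (p : hpoly H1) : hpoly H2 := HPoly (push_subproof p).

Definition RAC : Prop :=
  forall (p : hpoly H1) (b : H2), hroots (push_forward p) b ->
    exists a : H1, f a = b /\ hroots p a.

End PushForward.

Section MultTheory.
Variable H : hyperfieldType.
Implicit Types (a : H) (p q : hpoly H).

Lemma hmulx0 a : hmul a hzero = hzero.
Proof. by rewrite hmulC hmul0x. Qed.

Lemma haddx0 a : hadd a hzero = [set a].
Proof. by rewrite haddC hadd0x. Qed.

Lemma hmulNx a b : hmul (hopp a) b = hopp (hmul a b).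
Proof.
apply: hopp_unique; rewrite !(hmulC _ b) -hmulDr.
by exists hzero; [exact: haddxN | rewrite hmulx0].
Qed.

Lemma hpoly_size p : 0 < size p.
Proof. by case: p => -[|//] /=; rewrite eqxx. Qed.

Lemma hpoly_lead p : hcoef p (hdeg p) <> hzero.
Proof. by case: p => s sN0; rewrite /hcoef nth_last; apply/eqP. Qed.

Lemma mulXsub_deg a q p : mulXsub a q p -> hdeg p = (hdeg q).+1.
Proof.
move=> pq; have sq := hpoly_size q; have sp := hpoly_size p.
have dq : (hdeg q).+1 = size q by rewrite prednK.
have dp : (hdeg p).+1 = size p by rewrite prednK.
apply/eqP; rewrite eqn_leq; apply/andP; split; rewrite leqNgt; apply/negP => lt.
- have [j dpE] : exists j, hdeg p = j.+1 by case: (hdeg p) lt => // j; exists j.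
  have := pq (hdeg p); rewrite {1}dpE /hcoef !(nth_default hzero (s := q)) -?dq.
  + by rewrite hmulx0 hadd0x => /(@hpoly_lead p).
  + by rewrite (leq_trans _ lt).
  + by rewrite -ltnS -dpE.
- have := pq (hdeg q).+1; rewrite /= {2 3}/hcoef !nth_default -?dp -?dq //.
  by rewrite hmulx0 haddx0 => /esym/hpoly_lead.
Qed.

Lemma heval_cons a x (s : seq H) :
  \big[set_hyperadd hadd/[set hzero]]_(i < size (x :: s))
    [set hmul (nth hzero (x :: s) i) (hexp a i)] =
  set_hyperadd hadd [set x] (hmul a @`
    \big[set_hyperadd hadd/[set hzero]]_(i < size s)
      [set hmul (nth hzero s i) (hexp a i)]).
Proof.
rewrite big_ord_recl /= [hmul x _]hmulC hmul1x; congr set_hyperadd.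
pose K (A B : set H) := A = hmul a @` B.
apply: (big_ind2 K); rewrite /K.
- by rewrite image_set1 hmulx0.
- move=> _ A _ B -> ->; rewrite /set_hyperadd image_bigcup bigcup_image.
  apply: eq_bigcupr => b _; rewrite image_bigcup bigcup_image.
  by apply: eq_bigcupr => c _; rewrite hmulDr.
- by move=> i _; rewrite image_set1 /= hmulA [hmul _ a]hmulC -hmulA.
Qed.

Lemma heval_horner a x (s : seq H) (y : H) :
  (\big[set_hyperadd hadd/[set hzero]]_(i < size (x :: s))
      [set hmul (nth hzero (x :: s) i) (hexp a i)]) y ->
  exists d : seq H, [/\ size d = size s, last y d = last x s &
    forall i, hadd (nth hzero (y :: d) i) (hmul (hopp a) (nth hzero d i))
                   (nth hzero (x :: s) i)].
Proof.
elim: s x y => [|u s IH] x y; rewrite heval_cons.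
  rewrite big_ord0 image_set1 hmulx0 => -[_ -> [_ ->]].
  rewrite haddx0 => ->; exists [::]; split=> // i.
  by rewrite nth_nil hmulx0 haddx0; case: i => [|i] //=; rewrite nth_nil.
move=> -[_ -> [_ [z zs <-] yxz]].
have [d [sd ld dP]] := IH _ _ zs.
exists (z :: d); split; [by rewrite /= sd | by [] |].
case=> [|i] /=; last exact: dP.
by rewrite hmulNx -hadd_rev haddC.
Qed.

Lemma mulXsub_root a p : hroots p a -> exists q, mulXsub a q p.
Proof.
case: p => -[|x s] sN0; first by exfalso; move: sN0; rewrite /= eqxx.
move=> /heval_horner[d [sd ld dP]].
have dN0 : last hzero d != hzero by rewrite ld.
by exists (HPoly dN0) => i; have := dP i; case: i.
Qed.

Lemma mult_rec_le n a p : mult_rec n a p <= n.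
Proof.
elim: n p => //= n IH p; case: asboolP => // _; rewrite ltnS /set_max.
by case: xgetP => // m -> [[q _ <-] _].
Qed.

Lemma multE a p : mult a p =
  if `[< hroots p a >]
  then (set_max [set mult a q | q in [set q | mulXsub a q p]]).+1 else 0.
Proof.
rewrite {1}/mult; case dp: (hdeg p) => [|n] /=; case: asboolP => // pa.
  by have [q /mulXsub_deg] := mulXsub_root pa; rewrite dp.
congr (set_max _).+1; apply: eq_imagel => q /= /mulXsub_deg.
by rewrite /mult dp => -[->].
Qed.

Lemma mult_max a p : hroots p a ->
  is_max [set mult a q | q in [set q | mulXsub a q p]]
         (set_max [set mult a q | q in [set q | mulXsub a q p]]).
Proof.
move=> /mulXsub_root[q pq]; rewrite /set_max; apply: xgetPex.
set A := image _ _; pose P n := `[< A n >].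
have exP : exists n, P n by exists (mult a q); apply/asboolP; exists q.
have ubP n : P n -> n <= hdeg p.
  move=> /asboolP[r /mulXsub_deg -> <-].
  by apply: leq_trans (leqnSn _); exact: mult_rec_le.
exists (ex_maxn exP ubP); case: ex_maxnP => m /asboolP Am maxm.
by split=> // n An; apply: maxm; apply/asboolP.
Qed.

End MultTheory.

(* Main.v *)
From mathcomp Require Import all_boot.
From mathcomp Require Import boolp classical_sets cardinality fsbigop.
Require Import Defs.

(** Inheritance lets one split off simultaneously all roots of [p] lying over a
    given [b], counted with multiplicity; pushing this factorization forward
    shows that the multiplicity of [b] as a root of [f_* p] is at least the sum
    of the multiplicities of the roots of [p] over [b].  Summed over all [b],
    these lower bounds add up to [deg p = deg (f_* p)], so by the multiplicity
    bound [f_* p] cannot have a further root. *)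

Set Implicit Arguments.
Unset Strict Implicit.
Unset Printing Implicit Defensive.

Local Open Scope classical_set_scope.

Lemma sum_count_mem (T : eqType) (s t : seq T) :
  uniq s -> {subset t <= s} -> \sum_(a <- s) count_mem a t = size t.
Proof.
move=> s_uniq; elim: t => [|x t IH] ts /=; first by rewrite big1.
rewrite big_split /= IH => [|y yt]; last by rewrite ts // inE yt orbT.
rewrite -[RHS]add1n; congr addn; rewrite (bigD1_seq x) ?ts ?mem_head //= eqxx big1 // => a ax.
by rewrite eq_sym (negbTE ax).
Qed.

(** Converts a finitely supported multiplicity function into a list, the form in which inheritance
    takes its multisets of roots; the total multiplicity becomes a length. *)
Lemma seq_of_multiplicities (T : choiceType) (g : T -> nat) :
  finite_set [set a | g a != 0] ->
  exists s : seq T, (forall a, count_mem a s = g a) /\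
    size s = \big[addn/0]_(a \in [set: T]) g a.
Proof.
move=> gfin; set r := finite_support 0 [set: T] (fun i => g i).
have r_uniq : uniq r by exact: finite_support_uniq.
have memr a : (a \in r) = (g a != 0).
  rewrite /r in_finite_support; last first.
    by apply: sub_finite_set gfin => x [_ /= /eqP].
  by apply/idP/idP; rewrite inE /=; [case=> _ /eqP | move=> /eqP].
pose s := flatten [seq nseq (g a) a | a <- r].
have cs a : count_mem a s = g a.
  rewrite /s count_flatten sumnE !big_map.
  under eq_bigr do rewrite count_nseq.
  have [ar|ar] := boolP (a \in r).
    rewrite (bigD1_seq a) //= eqxx mul1n big1 ?addn0 // => x /negbTE xa.
    by rewrite xa.
  rewrite big_seq big1 => [|x xr].
    by apply/esym/eqP; move: ar; rewrite memr negbK.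
  by rewrite /=; case: eqVneq xr ar => // -> ->.
exists s; split=> //; rewrite -(@sum_count_mem _ r s) //.
  by apply: eq_bigr => a _; rewrite cs.
by move=> a; rewrite memr -cs -lt0n -has_count has_pred1.
Qed.

(** Both sides are sums of counts over the distinct entries of a list [s] realizing [g], and these
    sums compare term by term. *)
Lemma size_le_fsum (T : choiceType) (g : T -> nat) (t : seq T) :
  finite_set [set a | g a != 0] -> (forall a, count_mem a t <= g a) ->
  size t <= \big[addn/0]_(a \in [set: T]) g a.
Proof.
move=> /seq_of_multiplicities[s [cs <-]] ct.
have ts : {subset t <= s}.
  move=> a; rewrite -!has_pred1 !has_count => /leq_trans; apply.
  by rewrite cs; exact: ct.
have su : {subset s <= undup s} by move=> a; rewrite mem_undup.
rewrite -(sum_count_mem (undup_uniq s) su).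
rewrite -(sum_count_mem (undup_uniq s) (fun a at_ => su a (ts a at_))).
by apply: leq_sum => a _; rewrite cs; exact: ct.
Qed.

Section Factors.
Variable H : hyperfieldType.
Implicit Types (a : H) (p q : hpoly H).

(* Converse of [heval_horner]: Horner's scheme run backwards. *)
Lemma horner_heval a x y (s d : seq H) : size d = size s ->
  (forall i, hadd (nth hzero (y :: d) i) (hmul (hopp a) (nth hzero d i))
                  (nth hzero (x :: s) i)) ->
  (\big[set_hyperadd hadd/[set hzero]]_(i < size (x :: s))
      [set hmul (nth hzero (x :: s) i) (hexp a i)]) y.
Proof.
elim: s d x y => [|u s IH] [|z d] x y // => [_|[sd]] dP; rewrite heval_cons.
  rewrite big_ord0 image_set1 hmulx0; exists x => //; exists hzero => //.
  by have := dP 0; rewrite /= hmulx0 !haddx0 => ->.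
exists x => //; exists (hmul a z).
  by exists z => //; apply: IH sd _ => i; exact: (dP i.+1).
(* Reversibility moves [a z] across the relation at index 0. *)
by rewrite haddC hadd_rev -hmulNx; exact: (dP 0).
Qed.

(** In Horner's scheme the value at [a] sits in the place of the coefficient of [q] below index 0,
    which here is [hzero]. *)
Lemma mulXsub_hroots a q p : mulXsub a q p -> hroots p a.
Proof.
move=> pq; have := mulXsub_deg pq; have := hpoly_size p.
case: p pq => -[|x s] sN0 //= pq _.
rewrite /hdeg /= prednK ?hpoly_size // => sd.
by apply: (@horner_heval a x hzero s q) => // i; have := pq i; case: i.
Qed.

Lemma mult_gt0 a p : (0 < mult a p) = `[< hroots p a >].
Proof. by rewrite multE; case: asboolP. Qed.

Lemma mult_mulXsub a q p : mulXsub a q p -> mult a q < mult a p.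
Proof.
move=> pq; have pa := mulXsub_hroots pq; have [_] := mult_max pa.
by rewrite [mult a p]multE asboolT // ltnS; apply; exists q.
Qed.

(** Each factor raises the multiplicity by at least one, whatever that of [a] in [q]. *)
Lemma mult_mulXsub_nseq a n q p : mulXsub_seq (nseq n a) q p -> n <= mult a p.
Proof.
by elim: n p => //= n IH p [r /IH nr /mult_mulXsub]; exact: leq_ltn_trans.
Qed.

End Factors.

Section PushForward.
Variables (H1 H2 : hyperfieldType) (f : hyperfield_hom H1 H2).

Lemma hcoef_push (p : hpoly H1) i : hcoef (push_forward f p) i = f (hcoef p i).
Proof.
rewrite /hcoef /=; have [ip|ip] := ltnP i (size p); first exact: nth_map.
by rewrite !nth_default ?size_map ?hom0.
Qed.

Lemma hdeg_push (p : hpoly H1) : hdeg (push_forward f p) = hdeg p.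
Proof. by rewrite /hdeg size_map. Qed.

Lemma hom_opp x : f (hopp x) = hopp (f x).
Proof.
by apply: hopp_unique; rewrite -(hom0 f); apply: hom_add; exists hzero => //;
  exact: haddxN.
Qed.

Lemma mulXsub_push a (q p : hpoly H1) :
  mulXsub a q p -> mulXsub (f a) (push_forward f q) (push_forward f p).
Proof.
move=> pq i; have := hom_add (imageP f (pq i)).
(* At index 0 the absent coefficient is [hzero], which [f] preserves. *)
by rewrite hom_mul hom_opp -!hcoef_push; case: i => [|i]; rewrite ?hom0 -?hcoef_push.
Qed.

Lemma mulXsub_seq_push s (q p : hpoly H1) : mulXsub_seq s q p ->
  mulXsub_seq (map f s) (push_forward f q) (push_forward f p).
Proof.
elim: s p => [|a s IH] p /=; first by move=> ->.
by move=> [r /IH rs pr]; exists (push_forward f r) => //; exact: mulXsub_push.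
Qed.

(** Inheritance is applied only to the sublist [t] of entries over [b], so that every factor pushes
    forward to [X - b]. *)
Lemma count_map_le_mult (p : hpoly H1) (s : seq H1) (b : H2) :
    inheritance_at p -> (forall a, count_mem a s <= mult a p) ->
    size s <= hdeg p ->
  count_mem b (map f s) <= mult b (push_forward f p).
Proof.
move=> inh cs sp; pose t := [seq a <- s | f a == b].
have [a||q /mulXsub_seq_push] := inh t.
- by apply: leq_trans (cs a); apply: leq_count_subseq; exact: filter_subseq.
- by apply: leq_trans sp; rewrite size_filter count_size.
have -> : map f t = nseq (count_mem b (map f s)) b.
  have -> : map f t = filter (pred1 b) (map f s) by rewrite filter_map.
  by rewrite -size_filter; apply/all_pred1P; exact: filter_all.
exact: mult_mulXsub_nseq.
Qed.

End PushForward.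

Theorem theorem4p10 (H1 H2 : hyperfieldType)
    (H1_mult_eq : multiplicity_equality H1)
    (H1_inherit : inheritance_property H1)
    (H2_mult_bound : multiplicity_bound H2)
    (f : hyperfield_hom H1 H2) :
  RAC f.
Proof.
move=> p b bP; have [mfin mE] := H1_mult_eq p.
have [s [cs ss]] := seq_of_multiplicities mfin; rewrite mE in ss.
have [/mapP[a a_s ->]|bs] := boolP (b \in map f s).
  exists a; split=> //; apply/asboolP; rewrite -mult_gt0 -cs.
  by rewrite -has_count has_pred1.
have [bfin bound] := H2_mult_bound (push_forward f p).
(* Adding the root [b] outside the image gives a list of length [hdeg p + 1], too long for the
   bound. *)
suff: size (b :: map f s) <= hdeg (push_forward f p).
  by rewrite hdeg_push /= size_map ss ltnn.
apply: leq_trans bound; apply: size_le_fsum => // c /=.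
(* The point [b] occurs once in the extended list and, being a root, has multiplicity at least
   one. *)
have [<-|cb] := eqVneq b c.
  by rewrite (count_memPn bs) addn0 mult_gt0; apply/asboolP.
by apply: count_map_le_mult => [|a|]; rewrite ?cs ?ss.
Qed.
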